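(* Let $X$ be a real Hilbert space and let $T\colon X\to X$ be nonexpansive. Then the following are equivalent: (i) Both $T$ and $-T$ are super strongly nonexpansive. (ii) Both $T$ and $-T$ are strongly nonexpansive. (iii) $T$ is a contraction for large distances.
   Context: $T\colon X\to X$ is nonexpansive if $\|Tx-Ty\|\le\|x-y\|$ for all $x,y\in X$. $T$ is strongly nonexpansive if it is nonexpansive and, for all sequences $(x_n),(y_n)$ in $X$, if $(x_n-y_n)$ is bounded and $\|x_n-y_n\|-\|Tx_n-Ty_n\|\to0$, then $(x_n-y_n)-(Tx_n-Ty_n)\to0$. $T$ is super strongly nonexpansive if it is nonexpansive and, for all sequences $(x_n),(y_n)$ in $X$, $\|x_n-y_n\|^2-\|Tx_n-Ty_n\|^2\to0$ implies $(x_n-y_n)-(Tx_n-Ty_n)\to0$. $T$ is a contraction for large distances if for each $\epsilon>0$ there exists $K_\epsilon<1$ such that $\|Tx-Ty\|\le K_\epsilon\|x-y\|$ whenever $x,y\in X$ satisfy $\|x-y\|\ge\epsilon$. *)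

(* Defs.v *)
From mathcomp Require Import all_boot all_order all_algebra.
From mathcomp Require Import all_classical all_reals all_analysis.

Set Implicit Arguments.
Unset Strict Implicit.
Unset Printing Implicit Defensive.

Import Order.TTheory GRing.Theory Num.Theory.
Import numFieldNormedType.Exports.

Local Open Scope classical_set_scope.
Local Open Scope ring_scope.

(* A Hilbert space is a complete normed space whose norm comes from a
   symmetric positive definite bilinear form; completeness is carried by
   completeNormedModType. *)
Definition norm_induced_by (R : realType) (X : completeNormedModType R)
    (dot : {dot X for idfun}) : Prop :=
  forall x : X, `|x| = Num.sqrt (dot x x).

Definition nonexpansive (R : realType) (X : normedModType R) (T : X -> X) :
    Prop :=
  forall x y : X, `|T x - T y| <= `|x - y|.

Definition strongly_nonexpansive (R : realType) (X : normedModType R)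
    (T : X -> X) : Prop :=
  nonexpansive T /\
  forall x y : nat -> X,
    bounded_fun (fun n => x n - y n) ->
    (fun n => `|x n - y n| - `|T (x n) - T (y n)|) @ \oo --> (0 : R) ->
    (fun n => (x n - y n) - (T (x n) - T (y n))) @ \oo --> (0 : X).

Definition super_strongly_nonexpansive (R : realType) (X : normedModType R)
    (T : X -> X) : Prop :=
  nonexpansive T /\
  forall x y : nat -> X,
    (fun n => `|x n - y n| ^+ 2 - `|T (x n) - T (y n)| ^+ 2) @ \oo
      --> (0 : R) ->
    (fun n => (x n - y n) - (T (x n) - T (y n))) @ \oo --> (0 : X).

Definition contraction_for_large_distances (R : realType)
    (X : normedModType R) (T : X -> X) : Prop :=
  forall e : R, 0 < e ->
    exists2 K : R, K < 1 &
      forall x y : X, e <= `|x - y| -> `|T x - T y| <= K * `|x - y|.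

(* Main.v *)
(* Halving segments shows that a contraction estimate at distances in
   [e, 2e] holds at all distances >= e.  So if the estimate fails, it fails
   along bounded sequences x_n, y_n staying e apart with
   |x_n - y_n| - |Tx_n - Ty_n| -> 0; strong nonexpansiveness of T and of -T then
   makes both (x_n - y_n) -+ (Tx_n - Ty_n), hence x_n - y_n, tend to 0.
   Conversely a contraction for large distances forces x_n - y_n -> 0 as soon as
   |x_n - y_n|^2 - |Tx_n - Ty_n|^2 -> 0. *)
Require Import Defs.
From mathcomp Require Import all_boot all_order all_algebra.
From mathcomp Require Import all_classical all_reals all_analysis.
From mathcomp Require Import lra.

Import Order.TTheory GRing.Theory Num.Theory.
Import numFieldNormedType.Exports.

Local Open Scope classical_set_scope.
Local Open Scope ring_scope.

Lemma normB_opp (R : realType) (X : normedModType R) (u v : X) :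
  `|- u - - v| = `|u - v|.
Proof. by rewrite -opprD normrN. Qed.

Lemma nonexpansive_opp (R : realType) (X : normedModType R) (T : X -> X) :
  nonexpansive T -> nonexpansive (fun x => - T x).
Proof. by move=> hT x y; rewrite normB_opp. Qed.

Lemma contraction_for_large_distances_opp (R : realType) (X : normedModType R)
    (T : X -> X) :
  contraction_for_large_distances T ->
  contraction_for_large_distances (fun x => - T x).
Proof.
move=> cT e /cT[K K1 hK]; exists K => // x y exy.
by rewrite normB_opp; exact: hK.
Qed.

(** Induction on the number of halvings needed to reach length at most [2 * e]. A segment longer
    than [2 * e] has halves longer than [e]; the estimates on the two halves add up by the triangle
    inequality, with the same [K]. *)
Lemma contraction_annulus (R : realType) (X : normedModType R) (T : X -> X)
    (e K : R) : 0 < e ->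
  (forall x y, e <= `|x - y| <= 2 * e -> `|T x - T y| <= K * `|x - y|) ->
  forall x y, e <= `|x - y| -> `|T x - T y| <= K * `|x - y|.
Proof.
move=> e0 hK x y exy.
have [n] : exists n, `|x - y| <= 2 ^+ n * (2 * e).
  (* An integer above the ratio suffices, since [n < 2 ^ n]. *)
  exists (Num.bound (`|x - y| / (2 * e))).
  rewrite -ler_pdivrMr; last by lra.
  apply: le_trans (ltW (archi_boundP _)) _; first by rewrite divr_ge0; lra.
  by rewrite -natrX ler_nat ltnW// ltn_expl.
elim: n x y exy => [|n IH] x y exy.
  by rewrite mul1r => h; apply: hK; rewrite exy.
rewrite exprS => hn.
have [h|h] := leP `|x - y| (2 * e); first by apply: hK; rewrite exy.
pose d := 2^-1 *: (x - y); pose m := y + d.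
have dd : d + d = x - y by rewrite -mulr2n -scaler_nat scalerA divff ?scale1r.
have my : m - y = d by rewrite addrC addKr.
have xm : x - m = d by rewrite /m opprD addrA -dd addrK.
have nd : `|d| = `|x - y| / 2.
  by rewrite normrZ ger0_norm ?invr_ge0// mulrC.
have nxm : `|x - m| = `|x - y| / 2 by rewrite xm.
have nmy : `|m - y| = `|x - y| / 2 by rewrite my.
have h1 : `|T x - T m| <= K * `|x - m| by apply: IH; rewrite nxm; lra.
have h2 : `|T m - T y| <= K * `|m - y| by apply: IH; rewrite nmy; lra.
have := ler_distD (T m) (T x) (T y); rewrite nxm in h1; rewrite nmy in h2; lra.
Qed.

(** With [a] and [b] the distances before and after [T], [a^2 - b^2 = (a - b) * (a + b)], and
    [a + b] stays bounded because [b <= a]. *)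
Lemma super_strongly_nonexpansive_strongly (R : realType) (X : normedModType R)
    (T : X -> X) : super_strongly_nonexpansive T -> strongly_nonexpansive T.
Proof.
move=> [hT sT]; split=> // x y bxy cv; apply: sT.
have [M M0 hM] : exists2 M : R, 0 < M & forall n, `|x n - y n| <= M.
  (* [bounded_fun] only gives bounds strictly above [M], and [M] may be negative. *)
  have [M [_ hM]] := bxy; exists (Num.max M 0 + 1) => [|n].
    by rewrite ltr_pwDr// le_max lexx orbT.
  by apply: hM => //; rewrite ltr_pwDr// le_max lexx.
apply/norm_cvg0P.
apply: (@squeeze_cvgr _ _ _ _ (fun=> 0)
  (fun n => (`|x n - y n| - `|T (x n) - T (y n)|) * (2 * M))).
- near=> n; rewrite normr_ge0/=.
  have h := hT (x n) (y n); have h' := hM n.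
  have := normr_ge0 (T (x n) - T (y n)).
  rewrite subr_sqr ger0_norm; last by rewrite mulr_ge0 ?subr_ge0 ?addr_ge0.
  by move=> h0; apply: ler_wpM2l; lra.
- exact: cvg_cst.
- by rewrite -(mul0r (2 * M)); exact: cvgM cv (cvg_cst _).
Unshelve. all: by end_near. Qed.

Lemma strongly_nonexpansive_contraction (R : realType) (X : normedModType R)
    (T : X -> X) : strongly_nonexpansive T ->
  strongly_nonexpansive (fun x => - T x) -> contraction_for_large_distances T.
Proof.
move=> [hT sT] [_ sN] e e0; apply: contrapT => nK.
(* The constants [1 - 1 / (n + 1)] increase to 1; if one of them worked on the annulus, it would
   work at all distances at least [e]. *)
have /choice[p hp] : forall n : nat, exists p : X * X,
    e <= `|p.1 - p.2| <= 2 * e /\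
    (1 - n.+1%:R^-1) * `|p.1 - p.2| < `|T p.1 - T p.2|.
  move=> n; apply: contrapT => np; apply: nK; exists (1 - n.+1%:R^-1).
    by rewrite ltrBlDr ltrDl invr_gt0.
  apply: contraction_annulus e0 _ => x y exy; rewrite leNgt; apply/negP => h.
  by apply: np; exists (x, y).
pose x n := (p n).1; pose y n := (p n).2.
have bxy : bounded_fun (fun n => x n - y n).
  exists (2 * e); split; first exact: num_real.
  move=> M hM n _ /=; have [/andP[_ h] _] := hp n.
  by apply: le_trans h (ltW hM).
have cv : (fun n => `|x n - y n| - `|T (x n) - T (y n)|) @ \oo --> (0 : R).
  apply: (@squeeze_cvgr _ _ _ _ (fun=> 0) (fun n => n.+1%:R^-1 * (2 * e))).
  (* The choice of the pair bounds the gap by [|x n - y n| / (n + 1)], hence by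
     [2 * e / (n + 1)]. *)
  - near=> n; rewrite subr_ge0 hT/=.
    have [/andP[_ h] h'] := hp n; rewrite -/(x n) -/(y n) in h h'.
    have : n.+1%:R^-1 * `|x n - y n| <= n.+1%:R^-1 * (2 * e).
      by apply: ler_wpM2l; rewrite ?invr_ge0.
    by move: n.+1%:R^-1 h' => k h' hk; lra.
  - exact: cvg_cst.
  - by rewrite -(mul0r (2 * e)); exact: cvgM cvg_harmonic (cvg_cst _).
have cB := sT x y bxy cv.
have cD : (fun n => (x n - y n) - (- T (x n) - - T (y n))) @ \oo --> (0 : X).
  apply: sN => //; rewrite (_ : (fun n => _) =
    (fun n => `|x n - y n| - `|T (x n) - T (y n)|)) //.
  by apply/funext => n; rewrite normB_opp.
(* Adding the limits for [T] and [-T] cancels the images. *)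
have cS : (fun n => 2 *: (x n - y n)) @ \oo --> (0 : X).
  rewrite -(addr0 0).
  rewrite [X in X @ _](_ : _ = (fun n => (x n - y n) - (T (x n) - T (y n))) \+
    (fun n => (x n - y n) - (- T (x n) - - T (y n)))); first exact: cvgD cB cD.
  apply/funext => n /=.
  have -> : - T (x n) - - T (y n) = - (T (x n) - T (y n)) by rewrite opprD.
  by rewrite opprK addrACA addNr addr0 scaler_nat mulr2n.
have /cvgr0Pnorm_lt/(_ e e0)[N _ /(_ N (leqnn N))] := cS.
have [/andP[h _] _] := hp N; rewrite -/(x N) -/(y N) in h.
by rewrite /= normrZ ger0_norm//; lra.
Unshelve. all: by end_near. Qed.

Lemma contraction_super_strongly_nonexpansive (R : realType)
    (X : normedModType R) (T : X -> X) : nonexpansive T ->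
  contraction_for_large_distances T -> super_strongly_nonexpansive T.
Proof.
move=> hT cT; split=> // x y cv.
have cu : (fun n => x n - y n) @ \oo --> (0 : X).
  apply/cvgr0Pnorm_lt => e e0; have [K K1 hK] := cT e e0.
  (* [K] may be negative, so it is replaced by [L] before squaring *)
  pose L := Num.max K 0.
  have L0 : 0 <= L by rewrite le_max lexx orbT.
  have L1 : L < 1 by rewrite gt_max K1 ltr01.
  (* This is a lower bound for the difference of squares whenever [|x n - y n|] is at least [e], so
     eventually the distance is below [e]. *)
  have d0 : 0 < (1 - L ^+ 2) * e ^+ 2.
    by rewrite mulr_gt0 ?exprn_gt0// subr_gt0 expr_lt1.
  move/cvgr0Pnorm_lt/(_ _ d0) : cv; apply: filterS => n.
  apply: contraTT; rewrite -!leNgt => exy.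
  have h : `|T (x n) - T (y n)| <= L * `|x n - y n|.
    apply: le_trans (hK _ _ exy) _.
    by apply: ler_wpM2r => //; rewrite le_max lexx.
  have h2 : `|T (x n) - T (y n)| ^+ 2 <= L ^+ 2 * `|x n - y n| ^+ 2.
    by rewrite -exprMn lerXn2r ?nnegrE ?mulr_ge0.
  have h3 : (1 - L ^+ 2) * e ^+ 2 <= (1 - L ^+ 2) * `|x n - y n| ^+ 2.
    apply: ler_wpM2l; first by rewrite subr_ge0 expr_le1// ltW.
    by rewrite lerXn2r ?nnegrE// ltW.
  by apply: le_trans (ler_norm _); lra.
(* The image differences also tend to 0, being dominated by [|x n - y n|]. *)
rewrite -(subr0 0); apply: cvgB => //.
apply/norm_cvg0P; apply: (@squeeze_cvgr _ _ _ _ (fun=> 0)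
  (fun n => `|x n - y n|)).
- by near=> n; rewrite normr_ge0/= hT.
- exact: cvg_cst.
- exact/norm_cvg0P.
Unshelve. all: by end_near. Qed.

Theorem proposition5p3 (R : realType) (X : completeNormedModType R)
    (dot : {dot X for idfun}) (hdot : norm_induced_by dot)
    (T : X -> X) (hT : nonexpansive T) :
  ((super_strongly_nonexpansive T /\
      super_strongly_nonexpansive (fun x => - T x)) <->
   (strongly_nonexpansive T /\ strongly_nonexpansive (fun x => - T x))) /\
  ((strongly_nonexpansive T /\ strongly_nonexpansive (fun x => - T x)) <->
   contraction_for_large_distances T).
Proof.
have i_ii (S : X -> X) := @super_strongly_nonexpansive_strongly R X S.
have ii_iii := @strongly_nonexpansive_contraction R X T.
(* Condition (iii) is invariant under the change of sign, so it yields (i) for both maps and closes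
   the cycle. *)
have iii_i : contraction_for_large_distances T ->
    super_strongly_nonexpansive T /\
    super_strongly_nonexpansive (fun x => - T x).
  move=> cT; split; apply: contraction_super_strongly_nonexpansive => //.
    exact: nonexpansive_opp.
  exact: contraction_for_large_distances_opp.
split; split.
- by move=> [/i_ii ? /i_ii ?].
- by move=> [sT sN]; apply/iii_i/ii_iii.
- by move=> [sT sN]; exact: ii_iii.
- by move=> /iii_i[/i_ii ? /i_ii ?].
Qed.
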